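(* Let $n\in\mathbb{N}$ and let $M$ be an $n$-manifold with exactly one connected component. Then the following are equivalent: (1) the group Zariski topology on $\operatorname{Homeo}(M)$ is Hausdorff; (2) the group Zariski topology on $\operatorname{Homeo}(M)$ is a group topology; (3) $n\leq 1$.
   Context: Here $0\in\mathbb{N}$. An $n$-manifold is a second countable Hausdorff space in which every point has an open neighbourhood homeomorphic to $\mathbb{R}^n$ (so manifolds have no boundary). $\operatorname{Homeo}(M)$ is the group of all homeomorphisms of $M$ under composition. A group topology on a group $G$ is a topology on the set $G$ for which multiplication $G\times G\to G$ and inversion $G\to G$ are continuous. The group Zariski topology $\mathfrak{Z}_G$ on a group $G$ with identity $1_G$ is the topology on $G$ with subbasis consisting of the sets $\{x\in G \mid 1_G\neq g_0x^{k_0}g_1\cdots g_{l-1}x^{k_{l-1}}g_l\}$, where $l\in\mathbb{N}$, $g_0,\ldots,g_l\in G$ and $k_0,\ldots,k_{l-1}\in\mathbb{Z}$. *)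

(* Defs.v *)
From HB Require Import structures.
From mathcomp Require Import all_boot all_order all_algebra.
From mathcomp Require Import all_classical all_reals all_analysis.

Set Implicit Arguments.
Unset Strict Implicit.
Unset Printing Implicit Defensive.

Import numFieldNormedType.Exports.

Local Open Scope classical_set_scope.
Local Open Scope group_scope.

Definition homeomorphism (X Y : topologicalType) (f : X -> Y) : Prop :=
  exists g : Y -> X, [/\ cancel f g, cancel g f, continuous f & continuous g].

Definition homeomorphic (X Y : topologicalType) : Prop :=
  exists f : X -> Y, homeomorphism f.

(* The coercion of [U] to a type carries the subspace topology. *)
Definition manifold (R : realType) (n : nat) (M : topologicalType) : Prop :=
  [/\ @second_countable M, hausdorff_space M &
      forall x : M, exists U : set M,
        [/\ open U, U x & homeomorphic U 'rV[R]_n]].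

Definition one_connected_component (X : topologicalType) : Prop :=
  exists C : set X, range (connected_component [set: X]) = [set C].

(* The carrier of Homeo(M) is a plain set of functions: its topology as a
   subtype of [M -> M], if any, plays no role. *)
Definition homeo (M : topologicalType) : Type :=
  set_type [set f : M -> M | homeomorphism f].

HB.instance Definition _ (M : topologicalType) :=
  SubChoice.copy (homeo M) (set_type [set f : M -> M | homeomorphism f]).

Section HomeoGroup.
Variable M : topologicalType.
Implicit Types f g h : homeo M.

Lemma homeo_inj f g : val f =1 val g -> f = g.
Proof. by move=> fg; apply/val_inj/funext. Qed.

Lemma homeo_homeomorphism f : homeomorphism (val f).
Proof. exact: set_mem (valP f). Qed.

Definition mkhomeo (f : M -> M) (hf : homeomorphism f) : homeo M :=
  exist _ f (mem_set hf).

Lemma homeomorphism_id : homeomorphism (@id M).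
Proof. by exists id; split=> // x. Qed.

Lemma homeomorphism_comp f g : homeomorphism (val f \o val g).
Proof.
have [f' [ff' f'f cf cf']] := homeo_homeomorphism f.
have [g' [gg' g'g cg cg']] := homeo_homeomorphism g.
exists (g' \o f'); split.
- exact: can_comp.
- exact: can_comp.
- by move=> x; apply: continuous_comp; [exact: cg|exact: cf].
- by move=> x; apply: continuous_comp; [exact: cf'|exact: cg'].
Qed.

Definition homeo_inv_fun f : M -> M := sval (cid (homeo_homeomorphism f)).

Lemma homeo_inv_funP f :
  [/\ cancel (val f) (homeo_inv_fun f), cancel (homeo_inv_fun f) (val f),
      continuous (val f) & continuous (homeo_inv_fun f)].
Proof. exact: svalP (cid (homeo_homeomorphism f)). Qed.

Lemma homeomorphism_inv f : homeomorphism (homeo_inv_fun f).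
Proof. by have [ff' f'f cf cf'] := homeo_inv_funP f; exists (val f). Qed.

Definition homeo_one : homeo M := mkhomeo homeomorphism_id.
Definition homeo_mul f g : homeo M := mkhomeo (homeomorphism_comp f g).
Definition homeo_inv f : homeo M := mkhomeo (homeomorphism_inv f).

Lemma homeo_mulA : associative homeo_mul.
Proof. by move=> f g h; apply: homeo_inj. Qed.

Lemma homeo_one_mul : left_id homeo_one homeo_mul.
Proof. by move=> f; apply: homeo_inj. Qed.

Lemma homeo_mul_one : right_id homeo_one homeo_mul.
Proof. by move=> f; apply: homeo_inj. Qed.

Lemma homeo_inv_mul : left_inverse homeo_one homeo_inv homeo_mul.
Proof.
move=> f; apply: homeo_inj => x /=.
by have [ff' _ _ _] := homeo_inv_funP f; exact: ff'.
Qed.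

Lemma homeo_mul_inv : right_inverse homeo_one homeo_inv homeo_mul.
Proof.
move=> f; apply: homeo_inj => x /=.
by have [_ f'f _ _] := homeo_inv_funP f; exact: f'f.
Qed.

HB.instance Definition _ := isGroup.Build (homeo M)
  homeo_mulA homeo_one_mul homeo_mul_one homeo_inv_mul homeo_mul_inv.

End HomeoGroup.

#[short(type="groupWithTopologyType")]
HB.structure Definition GroupWithTopology := {G of Group G & Topological G}.

Definition is_group_topology (G : groupWithTopologyType) : Prop :=
  continuous (fun p : G * G => p.1 * p.2) /\ continuous (fun x : G => x^-1).

Definition expgz (G : groupType) (x : G) (k : int) : G :=
  match k with Posz m => x ^+ m | Negz m => x ^- m.+1 end.

(* This is g_0 x^{k_0} g_1 ... x^{k_{l-1}} g_l, the factors being multiplied in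
   increasing order of the index. *)
Definition group_word (G : groupType) (l : nat)
    (g : 'I_l.+1 -> G) (k : 'I_l -> int) (x : G) : G :=
  g ord0 * \prod_(i < l) (expgz x (k i) * g (lift ord0 i)).

Definition zariski_subbasis (G : groupType) : set (set G) :=
  [set U | exists (l : nat) (g : 'I_l.+1 -> G) (k : 'I_l -> int),
     U = [set x | 1 <> group_word g k x]].

(* [zariski G] is the group [G] with the group Zariski topology: the canonical
   topology of this alias is the one generated by [zariski_subbasis G]. *)
Definition zariski (G : groupType) : Type := G.

HB.instance Definition _ (G : groupType) := Group.on (zariski G).
HB.instance Definition _ (G : groupType) :=
  @isSubBaseTopological.Build (zariski G) (set G) (@zariski_subbasis G) id.

(* Main.v *)
Require Import Defs.
From mathcomp Require Import all_boot all_order all_algebra.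
From mathcomp Require Import all_classical all_reals all_analysis.
From mathcomp Require Import finmap ring lra.

(** In dimension at least two the group Zariski topology is irreducible: any
two nonempty open sets meet, so it is far from Hausdorff. A condition
[w(x) <> 1] that holds at [f] is witnessed by one point [p] with
[w(f)(p) <> p], and the value [w(x)(p)] depends only on what [x] does at the
finitely many points visited while the word is evaluated at [p]. So a
neighbourhood of [f] contains every [x] that agrees with [f] on some finite set
[A]; as [p] ranges over an open set, which is infinite, [A] can be kept away
from any prescribed finite set ([zariski_nbhs_agree]). Given neighbourhoods of
[f] and of [g] one thus gets finite sets [A] and [B], disjoint and with
disjoint images [f(A)] and [g(B)]. A connected manifold of dimension at least
two is not disconnected by a finite set, hence its homeomorphisms fixing a
finite set pointwise are transitive on the complement ([transitive_fixing]),
and some homeomorphism equals [f] on [A] and [g] on [B]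
([homeo_interpolation]).

In dimension one the order of the line gives the opposite conclusion. In
positive dimension the set of [f] such that [f(U)] meets [V] is Zariski open
for open [U] and [V]: a nonempty open set carries two noncommuting
homeomorphisms, and a conjugate [f g f^-1] of a homeomorphism [g] supported in
[U] fails to commute with one supported in [V] only if [f(U)] meets [V]
([zariski_hits_open]). On a 1-manifold, where an arc is squeezed by points on
its two sides, finitely many such conditions force a whole small arc to be
mapped into a given neighbourhood ([arc_sub_connected]); hence
[(f, x) |-> f(x)] and [(f, x) |-> f^-1(x)] are jointly continuous
([hits_ev_continuous]). Every map into the homeomorphism group which is
continuous in this sense together with its inverse is continuous for the
Zariski topology ([ev_continuous_zariski]), and applying this to multiplication
and inversion gives a group topology ([zariski_group_topology1]).

In dimension zero a connected manifold is a point. Finally, points are always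
Zariski closed, and a group topology with closed points is Hausdorff
([zariski_group_hausdorff]), which closes the cycle of implications. *)

Set Implicit Arguments.
Unset Strict Implicit.
Unset Printing Implicit Defensive.

Import Order.TTheory GRing.Theory Num.Theory.
Import numFieldNormedType.Exports.

Local Open Scope classical_set_scope.
Local Open Scope ring_scope.

(** * Charts *)

(** The trace of [A] on [C] is also closed in [C], its complement there being
    the trace of [B]. *)
Lemma connected_sub_open (T : topologicalType) (C A B : set T) (a : T) :
  connected C -> open A -> open B -> C `<=` A `|` B ->
  (forall x, C x -> A x -> B x -> False) -> C a -> A a -> C `<=` A.
Proof.
move=> conC oA oB CAB disj Ca Aa.
have <- : C `&` A = C.
  apply: conC; first by exists a.
    by exists A.
  exists (~` B); first exact: open_closedC.
  apply/seteqP; split=> x [Cx Hx]; split=> //.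
    by move=> Bx; exact: disj Cx Hx Bx.
  by have [//|/Hx] := CAB _ Cx.
by apply: subIsetr.
Qed.

(** A chart is presented by its inverse parametrisation [psi : E -> M], which is
    defined everywhere; [chi] is the coordinate map, meaningful on the range of
    [psi] only. *)
Definition chart (E M : topologicalType) (psi : E -> M) (chi : M -> E) :=
  [/\ cancel psi chi, continuous psi, open (range psi) &
      forall v, {for psi v, continuous chi}].

Lemma chart_open (E M : topologicalType) (psi : E -> M) chi (A : set E) :
  chart psi chi -> open A -> open (psi @` A).
Proof.
move=> [psiK _ oR cchi] oA; rewrite openE => _ [v Av <-].
have hA : nbhs (psi v) (chi @^-1` A).
  by apply: (cchi v); rewrite psiK; exact: open_nbhs_nbhs.
have hR : nbhs (psi v) (range psi) by apply: open_nbhs_nbhs; split=> //; exists v.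
apply: filterS2 hA hR => y /= Ay [w _ wy].
by exists w => //; rewrite -wy psiK in Ay.
Qed.

Lemma chart_comp (E E' M : topologicalType) (psi : E -> M) chi
    (k : E' -> E) (k' : E -> E') :
  chart psi chi -> cancel k k' -> cancel k' k -> continuous k ->
  continuous k' -> chart (psi \o k) (k' \o chi).
Proof.
move=> [psiK cpsi oR cchi] kK k'K ck ck'; split.
- exact: can_comp.
- by move=> v; apply: continuous_comp; [exact: ck|exact: cpsi].
- rewrite (_ : range _ = range psi)//; apply/seteqP; split=> y [v _ <-].
    by exists (k v).
  by exists (k' v) => //=; rewrite k'K.
- by move=> v; apply: continuous_comp; [exact: cchi|exact: ck'].
Qed.

Lemma homeomorphic_chart (E M : topologicalType) (U : set M) (p : M) :
  open U -> U p -> homeomorphic U E ->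
  exists (psi : E -> M) chi, chart psi chi /\ range psi p.
Proof.
move=> oU Up [f [g [fK gK cf cg]]].
pose chi x := match pselect (U x) with
  | left Ux => f (exist _ x (mem_set Ux)) | right _ => f (exist _ p (mem_set Up))
  end.
have chiE (u : U) : chi (\val u) = f u.
  rewrite /chi; case: pselect => [Ux|nU].
    by congr f; apply: val_inj.
  by case: nU; exact: set_valP.
have rE : range (fun v => \val (g v)) = U.
  apply/seteqP; split=> [_ [v _ <-]|x Ux]; first exact: set_valP.
  by exists (f (exist _ x (mem_set Ux))) => //; rewrite fK.
exists (fun v => \val (g v)), chi; split; last by rewrite rE.
split.
- by move=> v; rewrite chiE gK.
- by move=> v; apply: continuous_comp; [exact: cg|exact: initial_continuous].
- by rewrite rE.
- move=> v A; rewrite /= chiE gK => nA.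
  have : nbhs (g v) (f @^-1` A) by apply: cf; rewrite gK.
  rewrite nbhsE /= => -[_ [[B oB <-] /= Bgv] BA].
  rewrite nbhsE; exists (B `&` U).
    by split; [exact: openI|split => //; exact: set_valP].
  move=> x [Bx Ux] /=; rewrite -[x]/(\val (exist _ x (mem_set Ux) : U)) chiE.
  exact: BA.
Qed.

(** Composing with an affine map of [V] moves the origin to [p] and shrinks the
    closed unit ball into [W]; the range of the chart is unchanged. *)
Lemma chart_rescale (R : realType) (V : normedModType R) (M : topologicalType)
    (psi : V -> M) (chi : M -> V) (p : M) (W : set M) :
  chart psi chi -> range psi p -> open W -> W p ->
  exists psi' chi', [/\ chart psi' chi', psi' 0 = p &
    forall v : V, `|v| <= 1 -> W (psi' v)].
Proof.
move=> cpsi [v0 _ <-{p}] oW Wp.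
have : nbhs v0 (psi @^-1` W).
  by case: cpsi => _ cp _ _; apply: cp; exact: open_nbhs_nbhs.
move=> /nbhs_ballP[e /= e0 eW].
have r0 : e / 2 != 0 by rewrite gt_eqF// divr_gt0.
exists (psi \o (fun v => (e / 2) *: v + v0)),
       ((fun w => (e / 2)^-1 *: (w - v0)) \o chi); split.
- apply: chart_comp => //.
  + by move=> v; rewrite addrK scalerA mulVf// scale1r.
  + by move=> v; rewrite scalerA mulfV// scale1r subrK.
  + by move=> v; apply: cvgD; [exact: cvgZl_tmp cvg_id|exact: cvg_cst].
  + by move=> v; apply: cvgZl_tmp; apply: cvgB; [exact: cvg_id|exact: cvg_cst].
- by rewrite /= scaler0 add0r.
- move=> v v1; apply: eW; rewrite -ball_normE /= opprD addrCA subrr addr0.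
  rewrite normrN normrZ gtr0_norm ?divr_gt0//.
  by rewrite (le_lt_trans (ler_piMr _ v1)) ?ltr_pdivrMr ?divr_ge0 ?ltW//; lra.
Qed.

(** * Local homogeneity *)

Section Bump.
Variables (R : realType) (V : normedModType R).
Implicit Types u v w : V.

(** A compactly supported push of the origin to [u]: the translation by [u],
    damped by a tent function which vanishes off the unit ball. *)
Definition bump u v : V := v + Num.max 0 (1 - `|v|) *: u.

Lemma bump_out u v : 1 <= `|v| -> bump u v = v.
Proof. by move=> v1; rewrite /bump (max_idPl _) ?scale0r ?addr0// subr_le0. Qed.

Lemma bump0 u : bump u 0 = u.
Proof. by rewrite /bump normr0 subr0 (max_idPr _)// scale1r add0r. Qed.

Lemma tent_lipschitz v w :
  `|Num.max 0 (1 - `|v|) - Num.max 0 (1 - `|w|)| <= `|v - w|.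
Proof.
have := ler_dist_dist v w; move: `|v| `|w| `|v - w| => a b c.
by rewrite !ler_norml !maxEle => /andP[? ?]; case: ifP => ?; case: ifP => ?; lra.
Qed.

(** The tent is 1-Lipschitz, so [bump u] differs from the identity by a map of
    Lipschitz constant [`|u|]. This yields injectivity and continuity of the
    inverse when [`|u| < 1]. *)
Lemma bump_expand u v w :
  (1 - `|u|) * `|v - w| <= `|bump u v - bump u w|.
Proof.
have -> : bump u v - bump u w = (v - w) +
    (Num.max 0 (1 - `|v|) - Num.max 0 (1 - `|w|)) *: u.
  by rewrite /bump scalerBl opprD addrACA.
set c := _ *: u.
have hc : `|c| <= `|u| * `|v - w|.
  by rewrite /c normrZ mulrC ler_wpM2l// tent_lipschitz.
have : `|v - w| <= `|v - w + c| + `|c|.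
  by rewrite -{1}[v - w](addrK c) (le_trans (ler_normB _ _)).
by rewrite mulrBl mul1r; lra.
Qed.

Lemma tent_continuous : continuous (fun v => Num.max 0 (1 - `|v|)).
Proof.
move=> v; apply/cvgrPdist_lt => e e0.
have : \forall v' \near v, `|v - v'| < e by apply: cvgr_dist_lt => //; exact: cvg_id.
by apply: filterS => v'; apply: le_lt_trans; exact: tent_lipschitz.
Qed.

(** Points move along lines directed by [u], so an inverse image of [w] is
    [w - s u] where [s] solves the scalar equation [tent (w - s u) = s]. *)
Lemma bump_surj u w : exists v, bump u v = w.
Proof.
pose tent v : R := Num.max 0 (1 - `|v|).
pose f (s : R) : R := tent (w - s *: u) - s.
have cf : continuous f.
  move=> s; apply: cvgB; last exact: cvg_id.
  apply: (@continuous_comp _ _ _ (fun s : R => w - s *: u) tent); last first.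
    exact: tent_continuous.
  by apply: cvgB; [exact: cvg_cst|apply: cvgZr_tmp; exact: cvg_id].
have [|s _ fs] := @IVT R f 0 1 0 ler01 (continuous_subspaceT cf).
  have t0 v : 0 <= tent v by rewrite /tent le_max lexx.
  have t1 v : tent v <= 1 by rewrite /tent ge_max ler01 gerBl normr_ge0.
  have f0 : 0 <= f 0 by rewrite /f subr0.
  have f1 : f 1 <= 0 by rewrite /f subr_le0.
  by rewrite ge_min f1 orbT le_max f0.
exists (w - s *: u); rewrite /bump -/(tent (w - s *: u)).
by move/eqP : fs; rewrite subr_eq0 => /eqP ->; rewrite subrK.
Qed.

Lemma bump_homeomorphism u : `|u| < 1 -> homeomorphism (bump u).
Proof.
move=> u1; have u1' : 0 < 1 - `|u| by rewrite subr_gt0.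
pose g w := sval (cid (bump_surj u w)).
have gK : cancel g (bump u) by move=> w; rewrite /g; case: cid.
have fK : cancel (bump u) g.
  move=> v; apply/eqP; rewrite -subr_eq0 -normr_le0.
  by have := bump_expand u (g (bump u v)) v; rewrite gK subrr normr0 pmulr_rle0.
exists g; split => //.
- move=> v; apply: cvgD; first exact: cvg_id.
  by apply: cvgZr_tmp; exact: tent_continuous.
- move=> w; apply/cvgrPdist_lt => e e0.
  have : \forall w' \near w, `|w - w'| < (1 - `|u|) * e.
    by apply: cvgr_dist_lt; [exact: cvg_id|rewrite mulr_gt0].
  apply: filterS => w' ww'; rewrite -(ltr_pM2l u1').
  by rewrite (le_lt_trans (bump_expand _ _ _))// !gK.
Qed.

End Bump.

Lemma manifold_chart (R : realType) n (M : topologicalType) (p : M) (W : set M) :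
  manifold R n M -> open W -> W p ->
  exists (psi : 'rV[R]_n -> M) chi, [/\ chart psi chi, psi 0 = p &
    forall v, `|v| <= 1 -> W (psi v)].
Proof.
move=> [_ _ loc] oW Wp; have [U [oU Up hU]] := loc p.
have [psi [chi [cpsi rp]]] := homeomorphic_chart oU Up hU.
exact: chart_rescale cpsi rp oW Wp.
Qed.

Lemma closed_unit_ball_compact (R : realType) n :
  compact [set v : 'rV[R]_n | `|v| <= 1].
Proof.
apply: bounded_closed_compact.
  by exists 1; split => // x x1 v /= v1; rewrite (le_trans v1)// ltW.
rewrite (_ : mkset _ = (fun v : 'rV[R]_n => `|v|) @^-1` [set x | x <= 1])//.
apply: preimage_closed; last exact: closed_le.
by move=> v _; apply: norm_continuous.
Qed.

Section Extend.
Variables (E M : topologicalType) (psi : E -> M) (chi : M -> E) (K : set E).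
Hypotheses (cpsi : chart psi chi) (hM : hausdorff_space M) (cK : compact K).

Definition extend (k : E -> E) (y : M) : M :=
  if y \in range psi then psi (k (chi y)) else y.

Lemma extendE k v : extend k (psi v) = psi (k v).
Proof.
rewrite /extend mem_set; last by exists v.
by case: cpsi => -> .
Qed.

Lemma extend_out k y : (forall v, ~ K v -> k v = v) -> ~ (psi @` K) y ->
  extend k y = y.
Proof.
move=> kK Ky; rewrite /extend; case: ifPn => // /set_mem[v _ vy].
rewrite -vy; case: cpsi => -> _ _ _; rewrite kK// => Kv.
by apply: Ky; exists v.
Qed.

Lemma extend_can k k' : cancel k k' -> cancel (extend k) (extend k').
Proof.
move=> kK y; have [/set_mem[v _ <-]|yR] := boolP (y \in range psi).
  by rewrite !extendE kK.
by rewrite /extend (negbTE yR) (negbTE yR).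
Qed.

Lemma extend_continuous k : (forall v, ~ K v -> k v = v) -> continuous k ->
  continuous (extend k).
Proof.
move=> kK ck y; have [psiK cps oR cchi] := cpsi.
have [[v _ <-]|yR] := pselect (range psi y); move=> A /=.
- rewrite extendE => nA.
  have h1 : nbhs (psi v) (range psi) by apply: open_nbhs_nbhs; split=> //; exists v.
  have h2 : nbhs (psi v) (chi @^-1` (k @^-1` (psi @^-1` A))).
    by apply: (cchi v); apply: ck; apply: cps; rewrite psiK.
  by apply: filterS2 h1 h2 => _ [w _ <-] /=; rewrite extendE psiK.
- have yK : ~ (psi @` K) y by move=> [v _ vy]; apply: yR; exists v.
  rewrite extend_out// => nA.
  have h1 : nbhs y (~` (psi @` K)).
    apply: open_nbhs_nbhs; split=> //; apply: closed_openC.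
    apply: compact_closed => //; apply: continuous_compact => //.
    exact: continuous_subspaceT.
  by apply: filterS2 h1 nA => z zK Az /=; rewrite extend_out.
Qed.

(** A homeomorphism of the model with compact support extends by the identity:
    the image of the support is closed because [M] is Hausdorff. *)
Lemma extend_homeo k : homeomorphism k -> (forall v, ~ K v -> k v = v) ->
  exists h : homeo M, (forall v, val h (psi v) = psi (k v)) /\
    forall y, ~ (psi @` K) y -> val h y = y.
Proof.
move=> [k' [kk' k'k ck ck']] kK.
have k'K v : ~ K v -> k' v = v by move=> Kv; rewrite -{1}(kK v Kv) kk'.
have hk : homeomorphism (extend k).
  exists (extend k'); split.
  - exact: extend_can. - exact: extend_can.
  - exact: extend_continuous. - exact: extend_continuous.
exists (mkhomeo hk); split=> [v|y Ky] /=; first exact: extendE.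
exact: extend_out.
Qed.

End Extend.

(** Local homogeneity: [p] can be pushed to any nearby point without moving
    anything outside [W]. *)
Lemma homeo_push (R : realType) n (M : topologicalType) (p : M) (W : set M) :
  manifold R n M -> open W -> W p ->
  exists O, [/\ open O, O p & forall q, O q ->
    exists h : homeo M, val h p = q /\ forall y, ~ W y -> val h y = y].
Proof.
move=> manM oW Wp; have [psi [chi [cpsi psi0 psiW]]] := manifold_chart manM oW Wp.
exists (psi @` [set v | `|v| < 1]); split.
- apply: chart_open cpsi _.
  rewrite (_ : mkset _ = (fun v : 'rV[R]_n => `|v|) @^-1` [set x | x < 1])//.
  apply: open_comp; last exact: open_lt.
  by move=> v _; apply: norm_continuous.
- by exists 0 => //=; rewrite normr0 ltr01.
move=> q [u /= u1 <-]; have [_ hM _] := manM.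
have [|h [hpsi hout]] := extend_homeo cpsi hM (@closed_unit_ball_compact R n)
    (bump_homeomorphism u1).
  by move=> v /= /negP; rewrite -ltNge => /ltW /bump_out.
exists h; split; first by rewrite -psi0 hpsi bump0.
by move=> y Wy; apply: hout => -[v /= v1 vy]; apply: Wy; rewrite -vy; exact: psiW.
Qed.

Lemma manifold_no_isolated (R : realType) n (M : topologicalType) (p : M)
    (W : set M) : manifold R n.+1 M -> open W -> W p -> exists2 q, W q & q <> p.
Proof.
move=> manM oW Wp; have [psi [chi [[psiK _ _ _] psi0 psiW]]] :=
  manifold_chart manM oW Wp.
pose v : 'rV[R]_n.+1 := const_mx 1.
have v0 : v != 0.
  by apply/eqP => /rowP /(_ 0); rewrite !mxE; apply/eqP; rewrite oner_eq0.
exists (psi (`|v|^-1 *: v)).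
  by apply: psiW; rewrite normrZ normfV normr_id mulVf ?normr_eq0.
rewrite -psi0 => /(can_inj psiK)/eqP.
by rewrite scaler_eq0 invr_eq0 normr_eq0 (negbTE v0).
Qed.

Lemma manifold_open_infinite (R : realType) n (M : topologicalType) (W : set M)
    (F : seq M) : manifold R n.+1 M -> open W -> W !=set0 ->
  exists2 q, W q & q \notin F.
Proof.
move=> manM; elim: F W => [|a F IH] W oW [p Wp]; first by exists p.
have [_ hM _] := manM.
have oWa : open (W `\ a).
  apply: openI => //; apply: closed_openC.
  exact/accessible_closed_set1/hausdorff_accessible.
have [|q [Wq qa] qF] := IH _ oWa.
  have [pa|pa] := eqVneq p a; last by exists p; split=> //; apply/eqP.
  have [q Wq qp] := manifold_no_isolated manM oW Wp.
  by exists q; split=> //; rewrite -pa.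
by exists q => //; rewrite inE negb_or qF andbT; exact/eqP.
Qed.

(** * Group words and the Zariski topology of a group *)

Lemma continuous_pair (T U V : topologicalType) (f : T -> U) (g : T -> V) :
  continuous f -> continuous g -> continuous (fun x => (f x, g x)).
Proof.
move=> cf cg x.
exact: (@cvg_pair _ _ _ _ (nbhs (f x)) (nbhs (g x)) _ _ _ f g (cf x) (cg x)).
Qed.

Lemma continuousT_comp (T U V : topologicalType) (f : T -> U) (g : U -> V) :
  continuous f -> continuous g -> continuous (g \o f).
Proof. by move=> cf cg x; apply: continuous_comp; [exact: cf|exact: cg]. Qed.

Lemma continuous_fst (T U : topologicalType) : continuous (@fst T U).
Proof. by move=> p; exact: cvg_fst. Qed.

Lemma continuous_snd (T U : topologicalType) : continuous (@snd T U).
Proof. by move=> p; exact: cvg_snd. Qed.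

Section Words.
Local Open Scope group_scope.
Variables (T : Type) (G : groupType) (P : (T -> G) -> Prop) (F : T -> G).
Hypotheses (Pcst : forall c, P (fun=> c))
  (PM : forall A B, P A -> P B -> P (fun t => A t * B t))
  (PF : P F) (PFV : P (fun t => (F t)^-1)).

(** Every property of words in [F] considered here, such as continuity or
    dependence on finitely many values, is obtained by structural induction
    over the word. *)
Lemma group_word_closed l (g : 'I_l.+1 -> G) (k : 'I_l -> int) :
  P (fun t => group_word g k (F t)).
Proof.
have PX (A : T -> G) m : P A -> P (fun t => A t ^+ m).
  move=> PA; elim: m => [|m IH]; first exact: (Pcst 1).
  by under eq_fun do rewrite expgS; exact: PM.
have PZ z : P (fun t => expgz (F t) z).
  case: z => m /=; first exact: PX.
  by under eq_fun do rewrite -expVgn; exact: PX.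
apply: PM; first exact: Pcst.
have : forall s : seq 'I_l,
    P (fun t => \prod_(i <- s) (expgz (F t) (k i) * g (lift ord0 i))).
  elim=> [|i s IH]; first by under eq_fun do rewrite big_nil; exact: Pcst.
  by under eq_fun do rewrite big_cons; apply: PM => //; apply: PM.
by move=> /(_ (index_enum _)).
Qed.

End Words.

Section Zariski.
Variable G : groupType.
Local Open Scope group_scope.

Lemma zariski_basic_open (U : set (zariski G)) : @zariski_subbasis G U -> open U.
Proof.
move=> sU; exists [set U]; last by rewrite bigcup_set1.
move=> _ ->; exists [fset U]%fset; last by rewrite set_fset1 bigcap_set1.
by move=> V; rewrite !inE => /eqP ->; exact/mem_set.
Qed.

Lemma zariski_cvg (x : zariski G) (Q : set_system (zariski G)) : Filter Q ->
  (forall U, @zariski_subbasis G U -> U x -> Q U) -> Q --> x.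
Proof.
move=> FQ QU A; rewrite nbhsE => -[_ [[B Bsub <-] [C BC Cx]] BA].
have [D Dsub DC] := Bsub _ BC.
have QC : Q C.
  rewrite -DC; apply: filter_bigI => U UD; apply: QU; first exact/set_mem/Dsub.
  by move: Cx; rewrite -DC; apply.
by apply: filterS QC; apply: subset_trans BA => y Cy; exists C.
Qed.

(** Points are Zariski closed, and [x^-1 * y] is a continuous function of the
    pair [(x, y)] which is distinct from [1] at distinct points; a rectangle on
    which it remains so gives disjoint neighbourhoods. *)
Lemma zariski_group_hausdorff :
  is_group_topology (zariski G) -> hausdorff_space (zariski G).
Proof.
move=> [cM cV] x y; apply: contraPP => xy.
pose Z := zariski G.
have cD : continuous (fun p : Z * Z => p.1^-1 * p.2 : Z).
  have cP := continuous_pair (continuousT_comp (@continuous_fst Z Z) cV)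
    (@continuous_snd Z Z).
  exact: (continuousT_comp cP cM).
have : nbhs (x, y) [set p : zariski G * zariski G | 1 <> p.1^-1 * p.2].
  apply: (cD (x, y) [set z | 1 <> z]); apply: open_nbhs_nbhs; split; last first.
    by move=> /= e; apply: xy; rewrite -[LHS]mulg1 [X in _ * X]e mulgA mulgV mul1g.
  (* The word [1 * z * 1]. *)
  apply: zariski_basic_open; exists 1%N, (fun=> 1), (fun=> 1%R).
  apply/funext => z /=; rewrite /group_word big_ord1 mul1g.
  by rewrite -[expgz _ _]/(z ^+ 1) expg1 mulg1.
move=> [[A B] /= [nA nB] AB] /(_ A B nA nB)[z [Az Bz]].
by have /= := AB (z, z) (conj Az Bz); rewrite mulVg.
Qed.

End Zariski.

(** * Dimension at least two: finite interpolation by homeomorphisms *)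

Lemma segment_connected (R : realType) (V : normedModType R) (x y : V) :
  connected [set t *: y + (1 - t) *: x | t in `[(0 : R), 1]].
Proof.
apply: connected_continuous_connected.
  by apply/connected_intervalP; exact: interval_is_interval.
apply: continuous_subspaceT => t; apply: cvgD; apply: cvgZr_tmp; first exact: cvg_id.
by apply: cvgB; [exact: cvg_cst|exact: cvg_id].
Qed.

(** A vector [y] with a nonzero coordinate [j != 0] is joined to [e0] by a
    segment missing the origin; the others, multiples of [e0], are reached via
    [e1]. *)
Lemma punctured_connected (R : realType) n :
  connected [set v : 'rV[R]_n.+2 | v != 0].
Proof.
pose seg (x y : 'rV[R]_n.+2) := [set t *: y + (1 - t) *: x | t in `[(0 : R), 1]].
have seg0 x y : seg x y x.
  by exists 0; rewrite /= ?in_itv/= ?lexx ?ler01// scale0r add0r subr0 scale1r.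
have seg1 x y : seg x y y.
  by exists 1; rewrite /= ?in_itv/= ?lexx ?ler01// subrr scale0r addr0 scale1r.
have seg_nz (x y : 'rV[R]_n.+2) j : x != 0 -> x 0 j = 0 -> y 0 j != 0 ->
    seg x y `<=` [set v | v != 0].
  move=> x0 xj yj _ [t _ <-] /=; apply/eqP => /[dup] e /rowP /(_ j).
  rewrite !mxE xj mulr0 addr0 => /eqP; rewrite mulf_eq0 (negbTE yj) orbF => /eqP t0.
  by move: e; rewrite t0 scale0r add0r subr0 scale1r => /eqP; apply/negP.
pose e0 : 'rV[R]_n.+2 := delta_mx 0 0; pose e1 : 'rV[R]_n.+2 := delta_mx 0 1.
have e00 : e0 != 0.
  by apply/eqP => /rowP /(_ 0); rewrite !mxE !eqxx; apply/eqP; rewrite oner_eq0.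
have reach (y : 'rV[R]_n.+2) : y != 0 -> exists C : set 'rV[R]_n.+2,
    [/\ connected C, C e0, C y & C `<=` [set v | v != 0]].
  move=> y0; have [[j j0 yj]|yj] := pselect (exists2 j, j != 0 & y 0 j != 0).
    exists (seg e0 y); split => //; first exact: segment_connected.
    by apply: (seg_nz _ _ j) => //; rewrite mxE (negbTE j0) andbF.
  (* Here [y] is a multiple of [e0], so the segment from [y] to [e1] avoids 0. *)
  exists (seg e0 e1 `|` seg y e1); split; [|by left|by right|].
  - by apply: connectedU; [exists e1|exact: segment_connected..].
  - rewrite subUset; split; apply: (seg_nz _ _ 1) => //;
      rewrite ?mxE ?eqxx ?oner_eq0//.
    by apply: contrapT => y1; apply: yj; exists 1 => //; apply/eqP.
have {}/choice [C CP] : forall y : 'rV[R]_n.+2, exists C : set 'rV[R]_n.+2,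
    y != 0 -> [/\ connected C, C e0, C y & C `<=` [set v | v != 0]].
  move=> y; have [->|/reach [C CP]] := eqVneq y 0; first by exists set0.
  by exists C.
rewrite (_ : mkset _ = \bigcup_(y in [set v | v != 0]) C y).
  apply: bigcup_connected; last by move=> y /CP[].
  by exists e0 => y /CP[].
apply/seteqP; split=> [y y0|v [y /CP[_ _ _]]]; last exact.
by exists y => //; have [] := CP _ y0.
Qed.

Lemma squash_continuous (R : realType) (V : normedModType R) :
  continuous (fun v : V => (1 + `|v|)^-1 *: v).
Proof.
move=> v; have c1 : 1 + `|w| @[w --> v] --> 1 + `|v|.
  by apply: cvgD; [exact: cvg_cst|exact: norm_continuous].
by apply: cvgZ; [apply: cvgV c1; rewrite gt_eqF// ltr_pwDl|exact: cvg_id].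
Qed.

(** The punctured unit ball is connected as the image of the whole punctured
    space under [v |-> v / (1 + |v|)]. *)
Lemma manifold_punctured_nbhs (R : realType) n (M : topologicalType) (p : M)
    (W : set M) : manifold R n.+2 M -> open W -> W p ->
  exists N, [/\ open N, N p, N `<=` W & connected (N `\ p)].
Proof.
move=> manM oW Wp; have [psi [chi [cpsi psi0 psiW]]] := manifold_chart manM oW Wp.
have [psiK cps _ _] := cpsi.
exists (psi @` [set v | `|v| < 1]); split.
- apply: (chart_open cpsi).
  rewrite (_ : mkset _ = (fun v : 'rV[R]_n.+2 => `|v|) @^-1` [set x | x < 1])//.
  apply: open_comp; last exact: open_lt.
  by move=> v _; apply: norm_continuous.
- by exists 0 => //=; rewrite normr0 ltr01.
- by move=> _ [v /= v1 <-]; apply: psiW; exact: ltW.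
pose squash (v : 'rV[R]_n.+2) := (1 + `|v|)^-1 *: v.
have pos (v : 'rV[R]_n.+2) : 0 < 1 + `|v| by rewrite ltr_pwDl.
rewrite (_ : _ `\ p = (psi \o squash) @` [set v | v != 0]).
  apply: connected_continuous_connected; first exact: punctured_connected.
  apply: continuous_subspaceT; apply: continuousT_comp cps.
  exact: squash_continuous.
apply/seteqP; split=> [_ [[v /= v1 <-] /eqP vp]|_ [v /= v0 <-]].
  have v1' : 0 < 1 - `|v| by rewrite subr_gt0.
  have v0 : v != 0 by apply: contra vp => /eqP ->; rewrite psi0.
  exists ((1 - `|v|)^-1 *: v).
    by rewrite /= scaler_eq0 negb_or v0 invr_eq0 gt_eqF.
  congr psi; rewrite /squash scalerA normrZ normfV (gtr0_norm v1').
  rewrite (_ : _ * _ = 1) ?scale1r//; field.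
  by rewrite !gt_eqF//=; lra.
split.
  exists (squash v) => //=; rewrite /squash normrZ normfV gtr0_norm//.
  by rewrite mulrC ltr_pdivrMr// mul1r ltrDr.
rewrite /= -psi0 => /(can_inj psiK)/eqP.
by rewrite scaler_eq0 invr_eq0 gt_eqF//= (negbTE v0).
Qed.

Section Transitivity.
Variables (R : realType) (n : nat) (M : topologicalType).
Hypothesis manM : manifold R n.+2 M.
Local Open Scope group_scope.

Lemma homeoK (h : homeo M) : cancel (val h) (val h^-1).
Proof. by case: (homeo_inv_funP h). Qed.

Lemma homeoVK (h : homeo M) : cancel (val h^-1) (val h).
Proof. by case: (homeo_inv_funP h). Qed.

Lemma homeo_injective (h : homeo M) : injective (val h).
Proof. exact: can_inj (homeoK h). Qed.

Definition orbit_fixing (F : seq M) (a : M) : set M :=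
  [set y | exists h : homeo M, (forall z, z \in F -> val h z = z) /\ val h a = y].

Lemma orbit_fixing_trans F a b c :
  orbit_fixing F a b -> orbit_fixing F b c -> orbit_fixing F a c.
Proof.
move=> [h [hF hab]] [k [kF kbc]]; exists (k * h); split=> /= [z zF|].
  by rewrite hF// kF.
by rewrite hab.
Qed.

Lemma orbit_fixing_sym F a b : orbit_fixing F a b -> orbit_fixing F b a.
Proof.
move=> [h [hF hab]]; exists (h^-1); split=> [z zF|]; last by rewrite -hab homeoK.
by rewrite -{1}(hF z zF) homeoK.
Qed.

Lemma cofinite_open (F : seq M) : open [set y | y \notin F].
Proof.
have [_ hM _] := manM.
rewrite (_ : mkset _ = ~` [set` F]).
  apply: closed_openC; have /accessible_finite_set_closed := hausdorff_accessible hM.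
  by apply; exact: finite_seq.
by apply/seteqP; split=> y /= /negP.
Qed.

Lemma orbit_fixing_open F a : (forall y, y \in F -> ~ orbit_fixing F a y) ->
  open (orbit_fixing F a).
Proof.
move=> aF; rewrite openE => y ay.
have yF : y \notin F by apply/negP => /aF.
have [U [oU Uy Uq]] := homeo_push manM (cofinite_open F) yF.
rewrite /interior nbhsE; exists U => // q /Uq[h [hq hF]].
apply: orbit_fixing_trans ay _; exists h; split=> // z zF.
by apply: hF => /=; rewrite zF.
Qed.

Lemma orbit_fixing_notin F a y : a \notin F -> orbit_fixing F a y -> y \notin F.
Proof.
move=> aF [h [hF hay]]; apply: contra aF => yF.
by rewrite (@homeo_injective h a y) ?hay ?hF.
Qed.

(** The orbits of the homeomorphisms fixing [F] partition the complement of [F]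
    into open sets. *)
Lemma connected_orbit_fixing F (C : set M) a : connected C ->
  (forall y, C y -> y \notin F) -> C a -> C `<=` orbit_fixing F a.
Proof.
move=> cC CF Ca; have aF := CF _ Ca.
have oorb b : b \notin F -> open (orbit_fixing F b).
  by move=> bF; apply: orbit_fixing_open => y yF /(orbit_fixing_notin bF)/negP.
pose B := \bigcup_(b in [set b | b \notin F /\ ~ orbit_fixing F a b])
  orbit_fixing F b.
apply: (@connected_sub_open _ C _ B a) => //.
- exact: oorb.
- by apply: bigcup_open => b [bF _]; exact: oorb.
- move=> y Cy; have [|ay] := pselect (orbit_fixing F a y); first by left.
  by right; exists y; [split => //; exact: CF|exists 1].
- move=> y _ ay [b [_ nab]] yb; apply: nab.
  exact: orbit_fixing_trans ay (orbit_fixing_sym yb).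
- by exists 1.
Qed.

(** No finite set disconnects [M], because a punctured neighbourhood of a point
    of [F] is connected. Concretely: near every point of [M], even in [F], all
    points outside [F] belong to one orbit, so the set where this orbit is that
    of [a] is open and closed in [M]. *)
Lemma transitive_fixing F a b : connected [set: M] -> a \notin F -> b \notin F ->
  orbit_fixing F a b.
Proof.
move=> cM aF bF.
have loc y : exists N c, [/\ open N, N y &
    forall z, N z -> z \notin F -> orbit_fixing F c z].
  have yW : y \notin [seq z <- F | z != y] by rewrite mem_filter eqxx.
  have [N [oN Ny NW cN]] := manifold_punctured_nbhs manM (cofinite_open _) yW.
  have [yF|yF] := boolP (y \in F); last first.
    have [U [oU Uy Uq]] := homeo_push manM (cofinite_open F) yF.
    exists U, y; split => // z /Uq[h [hq hF]] _; exists h; split => // w wF.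
    by apply: hF => /=; rewrite wF.
  have [q Nq qy] := manifold_no_isolated manM oN Ny.
  exists N, q; split => // z Nz zF.
  apply: (connected_orbit_fixing cN) => //.
    move=> w [Nw wy]; apply/negP => wF; have /negP := NW _ Nw; apply.
    by rewrite mem_filter wF andbT; apply/eqP.
  by split => // zy; move: zF; rewrite zy yF.
pose A := \bigcup_(N in [set N | open N /\
  forall z, N z -> z \notin F -> orbit_fixing F a z]) N.
pose B := \bigcup_(N in [set N | open N /\
  forall z, N z -> z \notin F -> ~ orbit_fixing F a z]) N.
have AP z : A z -> z \notin F -> orbit_fixing F a z.
  by move=> [N [_ NP] Nz]; exact: NP.
have BP z : B z -> z \notin F -> ~ orbit_fixing F a z.
  by move=> [N [_ NP] Nz]; exact: NP.
have oA : open A by apply: bigcup_open => N [].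
have oB : open B by apply: bigcup_open => N [].
have AB y : A y \/ B y.
  have [N [c [oN Ny Nc]]] := loc y.
  have [ac|ac] := pselect (orbit_fixing F a c); [left|right];
    exists N => //; split => // z Nz zF.
    exact: orbit_fixing_trans ac (Nc _ Nz zF).
  move=> az; apply: ac; apply: orbit_fixing_trans az (orbit_fixing_sym _).
  exact: Nc.
apply: (AP b) => //; apply: (@connected_sub_open _ _ _ _ a cM oA oB) => //.
- by move=> y _; exact: AB.
- move=> y _ Ay By.
  have [|z [Az Bz] zF] := manifold_open_infinite F manM (openI oA oB).
    by exists y.
  exact: BP Bz zF (AP _ Az zF).
- by case: (AB a) => // /BP /(_ aF); case; exists 1.
Qed.

(** Starting from [f], the values at the points of [B] are corrected one at a
    time, by homeomorphisms that fix all the values already obtained. *)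
Lemma homeo_interpolation (f g : homeo M) (A B : seq M) : connected [set: M] ->
  (forall b, b \in B -> b \notin A) ->
  (forall a b, a \in A -> b \in B -> val f a <> val g b) ->
  exists x : homeo M, (forall a, a \in A -> val x a = val f a) /\
    (forall b, b \in B -> val x b = val g b).
Proof.
move=> cM; elim: B => [|b B IH] BA fg; first by exists f.
have [|a c aA cB|x [xA xB]] := IH.
- by move=> c cB; apply: BA; rewrite inE cB orbT.
- by apply: fg; rewrite // inE cB orbT.
have [bB|bB] := boolP (b \in B).
  by exists x; split => // c; rewrite inE => /predU1P[->|]; exact: xB.
pose F := map (val f) A ++ map (val g) B.
have [||h [hF hb]] := @transitive_fixing F (val x b) (val g b) cM.
- rewrite mem_cat negb_or; apply/andP; split; apply/mapP => -[c cA].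
    rewrite -xA// => /homeo_injective bc.
    by have /negP := BA b (mem_head _ _); rewrite bc.
  by rewrite -xB// => /homeo_injective bc; move: bB; rewrite bc cA.
- rewrite mem_cat negb_or; apply/andP; split; apply/mapP => -[c cA].
    by move/esym; apply: fg => //; rewrite mem_head.
  by move=> /homeo_injective bc; move: bB; rewrite bc cA.
exists (h * x); split=> c cA /=.
  by rewrite xA// hF// mem_cat map_f.
move: cA; rewrite inE => /predU1P[->//|cB].
by rewrite xB// hF// mem_cat map_f// orbT.
Qed.

End Transitivity.

Lemma near_neq (X T : topologicalType) (f g : X -> T) (x : X) :
  hausdorff_space T -> {for x, continuous f} -> {for x, continuous g} ->
  f x <> g x -> nbhs x [set y | f y <> g y].
Proof.
rewrite open_hausdorff => hT cf cg /eqP /hT[[A B] /= [/set_mem fA /set_mem gB]].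
move=> [oA oB /eqP AB0].
have nA : nbhs x (f @^-1` A) by apply: cf; exact: open_nbhs_nbhs.
have nB : nbhs x (g @^-1` B) by apply: cg; exact: open_nbhs_nbhs.
apply: filterS2 nA nB => y /= Ay By fgy.
have : (A `&` B) (f y) by split; rewrite // fgy.
by rewrite AB0.
Qed.

Lemma homeo_continuous (M : topologicalType) (h : homeo M) : continuous (val h).
Proof. by case: (homeo_inv_funP h). Qed.

Section Irreducible.
Local Open Scope group_scope.
Variable M : topologicalType.

(** The value of [W x] at [p] is determined by those of [x] at the points
    [v p], [v] in [vs]. The list [vs] does not depend on [p], so that [p] may
    later be chosen in general position. *)
Definition traced (f : homeo M) (W : homeo M -> homeo M) :=
  exists vs : seq (homeo M), forall p x,
    (forall v, v \in vs -> val x (val v p) = val f (val v p)) ->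
    val (W x) p = val (W f) p.

Lemma group_word_traced (f : homeo M) l (g : 'I_l.+1 -> homeo M) k :
  traced f (group_word g k).
Proof.
apply: (@group_word_closed _ _ (traced f) id).
- by move=> c; exists [::].
- move=> A B [vs vsP] [ws wsP]; exists (ws ++ [seq v * B f | v <- vs]) => p x agree.
  have BE : val (B x) p = val (B f) p.
    by apply: wsP => w wws; apply: agree; rewrite mem_cat wws.
  rewrite /= BE; apply: vsP => v vvs.
  apply: (agree (v * B f)); rewrite mem_cat; apply/orP; right.
  by apply/mapP; exists v.
- by exists [:: 1] => p x /(_ 1); rewrite mem_head; exact.
(* [x^-1] and [f^-1] agree at [p] as soon as [x] and [f] agree at [f^-1 p]. *)
- exists [:: f^-1] => p x /(_ f^-1); rewrite mem_head => /(_ isT).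
  by rewrite homeoVK => xp; apply: (@homeo_injective _ x); rewrite homeoVK xp.
Qed.

Variables (R : realType) (n : nat).
Hypothesis manM : manifold R n.+1 M.

(** Neighbourhoods of [f] contain the sets of finite agreement with [f], and the
    finite set can avoid any given [F]: the witness [p] of [w(f) <> 1] ranges
    over a nonempty open set, and only finitely many choices of [p] make a point
    [v p] fall into [F]. *)
Lemma zariski_nbhs_agree (f : zariski (homeo M)) (U : set (zariski (homeo M)))
    (F : seq M) : nbhs f U ->
  exists A : seq M, (forall a, a \in A -> a \notin F) /\
    forall x : homeo M, (forall a, a \in A -> val x a = val (f : homeo M) a) -> U x.
Proof.
pose Q : set_system (zariski (homeo M)) :=
  [set U : set (zariski (homeo M)) | forall F : seq M,
  exists A : seq M, (forall a, a \in A -> a \notin F) /\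
    forall x : homeo M, (forall a, a \in A -> val x a = val (f : homeo M) a) -> U x].
have FQ : Filter Q.
  split=> [G|U1 U2 Q1 Q2 G|U1 U2 U12 Q1 G]; first by exists [::].
    have [[A1 [A1G A1U]] [A2 [A2G A2U]]] := (Q1 G, Q2 G).
    exists (A1 ++ A2); split=> [a|x xA].
      by rewrite mem_cat => /orP[/A1G|/A2G].
    by split; [apply: A1U|apply: A2U] => a aA; apply: xA; rewrite mem_cat aA ?orbT.
  by have [A [AG AU]] := Q1 G; exists A; split => // x /AU /U12.
suff : Q --> f by move=> Qf /Qf /(_ F).
apply: zariski_cvg => _ [l [g [k ->]]] /= wf G.
have [_ hM _] := manM.
pose w := group_word g k; have [vs vsP] := group_word_traced f g k.
have [p wp] : exists p, val (w f) p <> p.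
  apply: contrapT => /forallNP nw; apply: wf; apply: homeo_inj => p.
  by have /contrapT -> := nw p.
have oW : open [set p | val (w f) p <> p].
  rewrite openE => q wq; apply: near_neq hM _ _ wq; last exact: cvg_id.
  exact: homeo_continuous.
have [|q wq qG] := manifold_open_infinite
    [seq val (v : homeo M)^-1 z | v <- vs, z <- G] manM oW.
  by exists p.
exists [seq val v q | v <- vs]; split.
  move=> _ /mapP[v vvs ->]; apply: contra qG => vG.
  by apply/allpairsP; exists (v, val v q); split => //; exact/esym/homeoK.
move=> x xA; have wx : val (w x) q = val (w f) q.
  by apply: vsP => v vvs; apply: xA; exact: map_f.
by move=> w1; apply: wq; rewrite -wx /w -w1.
Qed.

End Irreducible.

(** The finite set [B] on which [x] is to agree with [g] is chosen away from [A]
    and from [g^-1 (f A)], so that the two requirements are compatible. *)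
Lemma zariski_irreducible (R : realType) n (M : topologicalType)
    (f g : zariski (homeo M)) (U V : set (zariski (homeo M))) :
  manifold R n.+2 M -> connected [set: M] -> nbhs f U -> nbhs g V ->
  U `&` V !=set0.
Proof.
move=> manM cM nU nV.
have [A [_ AU]] := zariski_nbhs_agree manM [::] nU.
pose F := A ++ [seq val ((g : homeo M)^-1)%g (val (f : homeo M) a) | a <- A].
have [B [BF BV]] := zariski_nbhs_agree manM F nV.
have [||x [xA xB]] := @homeo_interpolation _ _ _ manM f g A B cM.
- by move=> b /BF; rewrite mem_cat negb_or => /andP[].
- move=> a b aA /BF /negP bF fg; apply: bF; rewrite mem_cat; apply/orP; right.
  by apply/mapP; exists a; rewrite // fg homeoK.
by exists x; split; [exact: AU|exact: BV].
Qed.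

Lemma zariski_not_hausdorff (R : realType) n (M : topologicalType) :
  manifold R n.+2 M -> connected [set: M] -> [set: M] !=set0 ->
  ~ hausdorff_space (zariski (homeo M)).
Proof.
move=> manM cM [p _] hZ.
have [U [oU Up Uq]] := homeo_push manM openT (I : [set: M] p).
have [q /Uq[h [hpq _]] qp] := manifold_no_isolated manM oU Up.
suff h1 : h = 1%g by apply: qp; rewrite -hpq h1.
apply: (hZ h (1%g : homeo M)) => A B nA nB.
exact: zariski_irreducible manM cM nA nB.
Qed.

(** * Commutators detect when the image of an open set meets another *)

Section Supports.
Variable M : topologicalType.
Local Open Scope group_scope.
Implicit Types (f g h : homeo M) (A B : set M).

Definition supported A h := forall y, ~ A y -> val h y = y.

Lemma supported_stable A h y : supported A h -> val h y <> y -> A (val h y).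
Proof.
by move=> sh hy; apply: contrapT => /sh /homeo_injective.
Qed.

(** Homeomorphisms with disjoint supports commute, since each preserves its own
    support. *)
Lemma disjoint_supported_comm A B g h : supported A g -> supported B h ->
  (forall y, A y -> B y -> False) -> g * h = h * g.
Proof.
move=> sg sh AB; apply: homeo_inj => y /=.
have gB z : B z -> val g z = z by move=> Bz; apply: sg => Az; exact: AB Az Bz.
have hA z : A z -> val h z = z by move=> Az; apply: sh => Bz; exact: AB Az Bz.
have [hy|hy] := pselect (val h y = y); last first.
  have Bh := supported_stable sh hy.
  have By : B y by apply: contrapT => /sh.
  by rewrite (gB _ Bh) (gB _ By).
have [gy|gy] := pselect (val g y = y); first by rewrite hy gy hy.
by rewrite hy (hA _ (supported_stable sg gy)).
Qed.

Lemma supported_conj A f g : supported A g -> supported (val f @` A) (f * g * f^-1).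
Proof.
move=> sg y fAy; rewrite -[LHS]/(val f (val g (val f^-1 y))) sg ?homeoVK// => Ay.
by apply: fAy; exists (val f^-1 y) => //; rewrite homeoVK.
Qed.

(** Let [g] move [p] to [q], and let [h] move [p] but fix [q]: then [h] fixes
    [g p], while [g (h p) <> g p]. *)
Lemma noncommuting_supported (R : realType) n (W : set M) :
  manifold R n.+1 M -> open W -> W !=set0 ->
  exists g h, [/\ supported W g, supported W h & g * h <> h * g].
Proof.
move=> manM oW [p Wp].
have [U [oU Up Uq]] := homeo_push manM oW Wp.
have [q /Uq[g [gp gW]] qp] := manifold_no_isolated manM oU Up.
have oWq : open (W `\ q).
  apply: openI => //; apply: closed_openC; have [_ hM _] := manM.
  exact/accessible_closed_set1/hausdorff_accessible.
have Wqp : (W `\ q) p by split=> // pq; apply: qp.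
have [U' [oU' U'p U'r]] := homeo_push manM oWq Wqp.
have [r /U'r[h [hp hW]] rp] := manifold_no_isolated manM oU' U'p.
exists g, h; split => //; first by move=> y Wy; apply: hW => -[].
move=> /(congr1 (fun k : homeo M => val k p)).
rewrite -[LHS]/(val g (val h p)) -[RHS]/(val h (val g p)) hp gp.
by rewrite (hW q) => [|[_ /(_ erefl)]//]; rewrite -gp => /homeo_injective.
Qed.

End Supports.

Section Hits.
Local Open Scope group_scope.

Lemma zariski_noncomm_open (G : groupType) (g h : G) :
  open ([set x | x * g * x^-1 * h <> h * (x * g * x^-1)] : set (zariski G)).
Proof.
apply: zariski_basic_open.
(* The word is [x g x^-1 h] times the inverse of [h x g x^-1]. *)
exists 4%N, (fun i => nth 1 [:: 1; g; h; g^-1; h^-1] i),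
  (fun i => nth 0%R [:: 1; -1; 1; -1]%R i).
apply/funext => x; apply/propext => /=.
have -> : group_word (fun i : 'I_5 => nth 1 [:: 1; g; h; g^-1; h^-1] i)
    (fun i : 'I_4 => nth 0%R [:: 1; -1; 1; -1]%R i) x =
    x * g * x^-1 * h * (h * (x * g * x^-1))^-1.
  rewrite /group_word !big_ord_recl big_ord0 /= mul1g mulg1.
  by rewrite /expgz /= !expg1 !invgM invgK !mulgA.
split=> [ne e|ne e]; apply: ne.
  by rewrite -[RHS]mul1g [X in _ = X * _]e -[RHS]mulgA mulVg mulg1.
by rewrite e mulgV.
Qed.

(** If [f u] lies in [V], two noncommuting homeomorphisms [g] and [h] supported
    near [u] give the witnesses [g], supported in [U], and [k = f h f^-1],
    supported in [V]: for every [x], if [x g x^-1] and [k] do not commute then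
    [x(U)] meets [V]. *)
Lemma zariski_hits_open (R : realType) n (M : topologicalType) (U V : set M) :
  manifold R n.+1 M -> open U -> open V ->
  open ([set f | exists2 u, U u & V (val (f : homeo M) u)] : set (zariski (homeo M))).
Proof.
move=> manM oU oV; rewrite openE => f [u Uu Vfu].
have oW : open (U `&` val (f : homeo M) @^-1` V).
  by apply: openI => //; apply: open_comp oV => y _; exact: homeo_continuous.
have [|g [h [sg sh gh]]] := noncommuting_supported manM oW; first by exists u.
rewrite /interior nbhsE.
pose k : homeo M := f * h * f^-1.
exists [set x : homeo M | x * g * x^-1 * k <> k * (x * g * x^-1)].
  split; first exact: zariski_noncomm_open.
  rewrite /k /= => e; apply: gh.
  have cK (a : homeo M) : f^-1 * (f * a * f^-1) * f = a.
    by rewrite !mulgA mulVg mul1g -mulgA mulVg mulg1.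
  have cM (a b : homeo M) : f * a * f^-1 * (f * b * f^-1) = f * (a * b) * f^-1.
    by rewrite !mulgA -[_ * f^-1 * f]mulgA mulVg mulg1.
  by rewrite -[LHS]cK -[RHS]cK -!cM e.
move=> x /=; apply: contra_notP => noU.
apply: (@disjoint_supported_comm _ (val (x : homeo M) @` U) V).
- by apply: supported_conj => y Uy; apply: sg => -[].
- rewrite /k => y Vy; apply: (supported_conj sh) => -[z [_ Vz] zy].
  by apply: Vy; rewrite -zy.
- by move=> _ [y Uy <-] Vy; apply: noU; exists y.
Qed.

End Hits.

(** * Dimension one: evaluation is jointly continuous *)

Section Line.
Variables (R : realType) (M : topologicalType).

Lemma manifold_line_chart (p : M) (W : set M) :
  manifold R 1 M -> open W -> W p ->
  exists (psi : R -> M) chi, [/\ chart psi chi, psi 0 = p &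
    forall t, `|t| <= 1 -> W (psi t)].
Proof.
move=> manM oW Wp; have [psi [chi [cpsi psi0 psiW]]] := manifold_chart manM oW Wp.
pose e : 'rV[R]_1 := const_mx 1.
have e0 : `|e| != 0.
  rewrite normr_eq0; apply/eqP => /rowP /(_ 0); rewrite !mxE.
  by apply/eqP; rewrite oner_eq0.
have scale_cont (V : normedModType R) (v : V) : continuous (fun t : R => t *: v).
  by move=> t; apply: cvgZr_tmp; exact: cvg_id.
have rescale_cont (V : topologicalType) (k : V -> R) : continuous k ->
    continuous (fun v => `|e| * k v).
  by move=> ck v; apply: cvgMl_tmp; exact: ck.
exists (psi \o (fun t : R => t *: (`|e|^-1 *: e))),
       ((fun v : 'rV[R]_1 => `|e| * v 0 0) \o chi); split.
- apply: (chart_comp cpsi).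
  + by move=> t; rewrite !mxE mulr1 mulrCA mulfV// mulr1.
  + move=> v; apply/rowP => i; rewrite !mxE ord1 mulr1 mulrAC mulfV ?mul1r//.
  + exact: scale_cont.
  + exact/rescale_cont/coord_continuous.
- by rewrite /= scale0r.
- by move=> t t1; apply: psiW; rewrite !normrZ normfV normr_id mulVf// mulr1.
Qed.

(** A connected set avoiding [psi y0] and [psi y3] cannot leave the arc between
    them: the open arc and the complement of the closed arc separate it. Inside
    the chart it is then an interval. *)
Lemma arc_sub_connected (psi : R -> M) chi (B : set M) (y0 y1 y2 y3 : R) :
  hausdorff_space M -> chart psi chi -> connected B ->
  y0 < y1 -> y2 < y3 -> B (psi y1) -> B (psi y2) -> ~ B (psi y0) -> ~ B (psi y3) ->
  forall t, y1 <= t <= y2 -> B (psi t).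
Proof.
move=> hM cpsi cB y01 y23 B1 B2 B0 B3 t /[dup] t12 /andP[t1 t2].
have [psiK cps _ cchi] := cpsi.
have Bsub : B `<=` psi @` `]y0, y3[.
  apply: (@connected_sub_open _ B _ (~` (psi @` `[y0, y3])) (psi y1)) => //.
  - by apply: (chart_open cpsi); exact: interval_open.
  - apply: closed_openC; apply: compact_closed => //; apply: continuous_compact.
      exact: continuous_subspaceT.
    exact: segment_compact.
  - move=> y By; have [[s + sy]|] := pselect ((psi @` `[y0, y3]) y); last by right.
    rewrite /= in_itv/= => /andP[s0 s3]; left; exists s => //=; rewrite in_itv/=.
    rewrite !lt_neqAle s0 s3 !andbT; apply/andP; split; apply/eqP => e.
      by apply: B0; rewrite e sy.
    by apply: B3; rewrite -e sy.
  - move=> y _ [s /= s03 sy]; apply; exists s => //=; move: s03.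
    by rewrite !in_itv/= => /andP[/ltW -> /ltW ->].
  - by exists y1 => //=; rewrite in_itv/= y01 (le_lt_trans t1)// (le_lt_trans t2).
have : is_interval (chi @` B).
  apply/connected_intervalP/connected_continuous_connected => //.
  apply: continuous_in_subspaceT => _ /set_mem /Bsub [s _ <-]; exact: cchi.
move=> /(_ y1 y2) /(_ _ _ t t12)[||_ /[dup] /Bsub[s _ <-] Bs].
- by exists (psi y1).
- by exists (psi y2).
- by rewrite psiK => <-.
Qed.

Hypothesis manM : manifold R 1 M.

(** Joint continuity of the evaluation: this replaces continuity of [F] into the
    compact-open topology. *)
Definition ev_continuous (T : topologicalType) (F : T -> homeo M) :=
  continuous (fun tx : T * M => val (F tx.1) tx.2).

(** Choose a chart at [x] such that [F t0] maps the arc ]-1, 1[ into [V]. If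
    [F t] sends some point of each of the arcs ]-2, -1[, ]-1, -1/2[, ]1/2, 1[ and
    ]1, 2[ into the image of the same arc under [F t0], then the preimage [B]
    under [F t] of the image of ]-1, 1[ is connected, meets the arc on both
    sides of ]-1/2, 1/2[, and misses a point further out on each side; so it
    contains ]-1/2, 1/2[. Without the outer arcs, [B] might go around the other
    way when [M] is a circle. *)
Lemma hits_ev_continuous (T : topologicalType) (F : T -> homeo M) :
  (forall U V, open U -> open V -> open [set t | exists2 u, U u & V (val (F t) u)]) ->
  ev_continuous F.
Proof.
move=> hitF [t0 x] V' /=; rewrite nbhsE => -[V [oV Vx] VV'].
have [_ hM _] := manM.
have oW : open (val (F t0) @^-1` V).
  by apply: open_comp oV => y _; exact: homeo_continuous.
have [psi [chi [cpsi psi0 psiW]]] := manifold_line_chart manM oW Vx.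
have [psiK cps _ _] := cpsi.
pose arc (a b : R) := psi @` `]a, b[.
have oarc a b : open (arc a b) by apply: (chart_open cpsi); exact: interval_open.
have psi_inj := can_inj psiK.
pose track a b := [set t | exists2 u, arc a b u &
  (val (F t0) @` arc a b) (val (F t) u)].
have ntrack a b : a < b -> nbhs t0 (track a b).
  move=> ab; apply: open_nbhs_nbhs; split.
    apply: hitF => //.
    rewrite (_ : _ @` _ = val ((F t0)^-1)%g @^-1` arc a b).
      by apply: open_comp => // y _; exact: homeo_continuous.
    apply/seteqP; split=> [_ [y ay <-]|y ay].
      by move: ay; rewrite -{1}(homeoK (F t0) y).
    by exists (val ((F t0)^-1)%g y) => //; rewrite homeoVK.
  have mid : arc a b (psi ((a + b) / 2)).
    by exists ((a + b) / 2) => //=; rewrite in_itv/= !midf_lt.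
  by exists (psi ((a + b) / 2)) => //; exists (psi ((a + b) / 2)).
have nx : nbhs x (arc (- 2^-1) 2^-1).
  by apply: open_nbhs_nbhs; split=> //; exists 0 => //=; rewrite in_itv/=; lra.
exists (track (-2) (-1) `&` track (-1) (- 2^-1) `&`
          (track 2^-1 1 `&` track 1 2), arc (- 2^-1) 2^-1).
  by split => //=; apply: filterI; apply: filterI; apply: ntrack; lra.
move=> [t _] /= [[[tr0 tr1] [tr2 tr3]] [s /= /[!in_itv]/= /andP[s1 s2] <-]].
have trackE a b : track a b t -> exists y z,
    [/\ a < y < b, a < z < b & val (F t) (psi y) = val (F t0) (psi z)].
  move=> [_ [y /= yab <-] [_ [z /= zab <-] e]].
  by move: yab zab; rewrite !in_itv => yab zab; exists y, z.
have [y0 [z0 [/andP[? ?] /andP[? ?] e0]]] := trackE _ _ tr0.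
have [y1 [z1 [/andP[? ?] /andP[? ?] e1]]] := trackE _ _ tr1.
have [y2 [z2 [/andP[? ?] /andP[? ?] e2]]] := trackE _ _ tr2.
have [y3 [z3 [/andP[? ?] /andP[? ?] e3]]] := trackE _ _ tr3.
pose B := (val ((F t)^-1)%g \o val (F t0) \o psi) @` `]-1, 1[.
have cB : connected B.
  apply: connected_continuous_connected.
    by apply/connected_intervalP; exact: interval_is_interval.
  apply: continuous_subspaceT; apply: (continuousT_comp cps).
  by apply: continuousT_comp; exact: homeo_continuous.
have BP y : B y <-> exists2 z, -1 < z < 1 & val (F t) y = val (F t0) (psi z).
  split=> [[z /= /[!in_itv]/= zB <-]|[z zB yz]].
    by exists z => //; exact: homeoVK.
  by exists z; rewrite /= ?in_itv//= -yz; exact: homeoK.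
have notB y z : val (F t) (psi y) = val (F t0) (psi z) -> ~~ (-1 < z < 1) ->
    ~ B (psi y).
  move=> yz zB /BP[z']; rewrite yz => z'B /homeo_injective /psi_inj e.
  by rewrite e z'B in zB.
have : B (psi s).
  apply: (@arc_sub_connected psi chi B y0 y1 y2 y3) => //.
  - by lra.
  - by lra.
  - by apply/BP; exists z1 => //; lra.
  - by apply/BP; exists z2 => //; lra.
  - by apply: notB e0 _; apply/negP; lra.
  - by apply: notB e3 _; apply/negP; lra.
  - by apply/andP; split; lra.
move=> /BP[z /andP[? ?] ->]; apply: VV'; apply: psiW.
by rewrite ler_norml; lra.
Qed.

End Line.

Section EvContinuous.
Local Open Scope group_scope.
Variable M : topologicalType.

Lemma ev_continuousM (T : topologicalType) (F G : T -> homeo M) :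
  ev_continuous F -> ev_continuous G -> ev_continuous (fun t => F t * G t).
Proof.
move=> cF cG.
have cFG := continuous_pair (@continuous_fst T M) cG.
exact: (continuousT_comp cFG cF).
Qed.

Lemma ev_continuous_comp (S T : topologicalType) (s : S -> T) (F : T -> homeo M) :
  continuous s -> ev_continuous F -> ev_continuous (F \o s).
Proof.
move=> cs cF.
have c := continuous_pair (continuousT_comp (@continuous_fst S M) cs)
  (@continuous_snd S M).
exact: (continuousT_comp c cF).
Qed.

(** If [w(F t)] moves [p] then, [M] being Hausdorff, so does [w(F s)] for [s]
    near [t]. *)
Lemma ev_continuous_zariski (T : topologicalType) (F : T -> homeo M) :
  hausdorff_space M -> ev_continuous F -> ev_continuous (fun t => (F t)^-1) ->
  continuous (F : T -> zariski (homeo M)).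
Proof.
move=> hM cF cFV t; apply: zariski_cvg => _ [l [g [k ->]]] /= wt.
have cw : ev_continuous (fun t => group_word g k (F t)).
  apply: (@group_word_closed _ _ (@ev_continuous M T)) => //.
    move=> c; apply: (continuousT_comp (@continuous_snd T M)).
    exact: homeo_continuous.
  exact: ev_continuousM.
have [p wp] : exists p, val (group_word g k (F t)) p <> p.
  apply: contrapT => /forallNP nw; apply: wt; apply: homeo_inj => p.
  by have /contrapT -> := nw p.
have cwp : {for t, continuous (fun t => val (group_word g k (F t)) p)}.
  have cid : continuous (@id T) by move=> s; exact: cvg_id.
  have c := continuous_pair cid (@cst_continuous T M p).
  exact: (continuousT_comp c cw).
apply: filterS (near_neq hM cwp (@cst_continuous T M p t) wp) => s /= ws w1.
exact/ws/(congr1 (fun h : homeo M => val h p) (esym w1)).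
Qed.

(** Inversion is covered by symmetry: [f^-1 (U)] meets [V] if and only if
    [f (V)] meets [U]. *)
Lemma zariski_group_topology1 (R : realType) :
  manifold R 1 M -> is_group_topology (zariski (homeo M)).
Proof.
move=> manM; have [_ hM _] := manM.
pose Z := zariski (homeo M).
have cid : ev_continuous (fun f : Z => f : homeo M).
  apply: (hits_ev_continuous manM) => U V; exact: (zariski_hits_open manM).
have cinv : ev_continuous (fun f : Z => (f : homeo M)^-1).
  apply: (hits_ev_continuous manM) => U V oU oV.
  rewrite (_ : mkset _ = [set f : Z | exists2 v, V v & U (val (f : homeo M) v)]).
    exact: (zariski_hits_open manM).
  apply/seteqP; split=> f [u Uu Vu].
    by exists (val (f : homeo M)^-1 u) => //; rewrite homeoVK.
  by exists (val (f : homeo M) u) => //; rewrite homeoK.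
have c1 := continuous_fst (T := Z) (U := Z).
have c2 := continuous_snd (T := Z) (U := Z).
split; apply: ev_continuous_zariski => //.
- exact: ev_continuousM (ev_continuous_comp c1 cid) (ev_continuous_comp c2 cid).
- rewrite (_ : (fun _ => _) = fun p : Z * Z =>
      (p.2 : homeo M)^-1 * (p.1 : homeo M)^-1).
    exact: ev_continuousM (ev_continuous_comp c2 cinv) (ev_continuous_comp c1 cinv).
  by apply/funext => p; exact: invgM.
- by rewrite (_ : (fun _ => _) = id)//; apply/funext => f; exact: invgK.
Qed.

(** * Dimension zero, and the equivalence *)

Lemma zariski_group_topology0 (R : realType) :
  manifold R 0 M -> connected [set: M] -> is_group_topology (zariski (homeo M)).
Proof.
move=> [_ hM loc] cM.
have M1 (x y : M) : x = y.
  have [U [oU Ux [k [k' [kK _ _ _]]]]] := loc x.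
  have U1 z : U z -> z = x.
    move=> Uz; have := can_inj kK (x1 := SigSub (mem_set Uz))
      (x2 := SigSub (mem_set Ux)).
    by move=> /(_ (etrans (thinmx0 _) (esym (thinmx0 _))))/(congr1 val).
  have cx : closed [set x] by exact/accessible_closed_set1/hausdorff_accessible.
  have : [set: M] `<=` U.
    apply: (@connected_sub_open _ _ U (~` [set x]) x cM oU) => //.
    - exact: closed_openC.
    - move=> z _; have [->|zx] := pselect (z = x); first by left.
      by right.
    - by move=> z _ /U1.
  by move=> /(_ y I) /U1.
have all1 (f g : zariski (homeo M)) : f = g by apply: homeo_inj => x; exact: M1.
have all_cst (T : topologicalType) (F : T -> zariski (homeo M)) : continuous F.
  have -> : F = cst (1 : homeo M) by apply/funext => t; exact: all1.
  exact: cst_continuous.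
by split; exact: all_cst.
Qed.

End EvContinuous.

Lemma one_component_connected (M : topologicalType) :
  one_connected_component M -> connected [set: M] /\ [set: M] !=set0.
Proof.
move=> [C CE].
have [p _ pC] : range (connected_component [set: M]) C by rewrite CE.
split; last by exists p.
suff <- : connected_component [set: M] p = setT by exact: component_connected.
apply/seteqP; split => // x _.
have : range (connected_component [set: M]) (connected_component setT x) by exists x.
by rewrite CE pC => <-; exact: connected_component_refl.
Qed.

Theorem theorem2p5 (R : realType) (n : nat) (M : topologicalType)
    (manM : manifold R n M) (oneM : one_connected_component M) :
  [<-> hausdorff_space (zariski (homeo M));
       is_group_topology (zariski (homeo M));
       (n <= 1)%N].
Proof.
have [cM M0] := one_component_connected oneM.
have dim_le1 : hausdorff_space (zariski (homeo M)) -> (n <= 1)%N.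
  case: n manM => [|[|n]]// man2 hZ; case: (zariski_not_hausdorff man2 cM M0 hZ).
have group_top : (n <= 1)%N -> is_group_topology (zariski (homeo M)).
  clear dim_le1; case: n manM => [|[|n]]// man2 _.
    exact: zariski_group_topology0 man2 cM.
  exact: zariski_group_topology1 man2.
tfae.
- by move=> /dim_le1 /group_top.
- by move=> /zariski_group_hausdorff /dim_le1.
- by move=> /group_top /zariski_group_hausdorff.
Qed.
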